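(* Let $\{G_i,f_i\}_{i=1}^\infty$ be a uniform tower such that $G_i$ is $d_i$-regular for each $i\in\mathbb{N}$. Then $\{A(G_i)/d_i\}_{i=1}^\infty$ is an action convergent sequence of $P$-operators and $\lim_{i\to\infty}d_M(A(G_i)/d_i,A)=0$, where $A$ is the inverse limit of the tower.
   Context: For a finite graph $G$ on $[n]$, $A(G)$ is the operator on functions $v:[n]\to\mathbb{R}$ (with the uniform probability measure on $[n]$) given by $(vA(G))(i)=\sum_{(j,i)\in E(G)}v(j)$. A map $f:V(G_2)\to V(G_1)$ between finite graphs is $(a,b)$-uniform if it is a graph homomorphism, $|f^{-1}(v)|=a$ for every $v\in V(G_1)$, and for every $v\in V(G_2)$ and every neighbor $w$ of $f(v)$ exactly $b$ neighbors of $v$ are mapped to $w$. A uniform tower is a sequence of finite graphs $G_i$ with maps $f_i:V(G_{i+1})\to V(G_i)$ that are $(a_i,b_i)$-uniform. Let $V$ be the inverse limit of $(V(G_i),f_i)$ (sequences $(x_1,x_2,\dots)$ with $f_i(x_{i+1})=x_i$), $\pi_i:V\to V(G_i)$ the projections, and $\mu$ the unique Borel probability measure on $V$ whose pushforward under each $\pi_i$ is uniform. For $x\in V$ let $N(x)\subseteq V$ be the inverse limit of the neighbor sets of $\pi_i(x)$ in $G_i$ and $\nu_x$ the uniform measure on $N(x)$. The inverse limit of the tower is the operator $A$ on $L^\infty(V,\mu)$ given by $(fA)(x)=\int_Vf\,d\nu_x$. For an operator $B$ on a probability space $\Omega$, $\mathcal{S}_k(B)$ is the set of joint distributions on $\mathbb{R}^{2k}$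 of $(v_1,\dots,v_k,v_1B,\dots,v_kB)$ with $v_i$ measurable $\Omega\to[-1,1]$; $d_M(B,C)=\sum_k2^{-k}d_H(\mathcal{S}_k(B),\mathcal{S}_k(C))$ with $d_H$ the Hausdorff distance induced by the Lévy–Prokhorov metric; action convergence means each $\{\mathcal{S}_k\}$ is $d_H$-Cauchy. *)

(* Defs.v *)
From HB Require Import structures.
From mathcomp Require Import all_boot all_order all_algebra.
From mathcomp Require Import all_classical all_reals all_analysis.
Set Implicit Arguments. Unset Strict Implicit. Unset Printing Implicit Defensive.
Import Order.TTheory GRing.Theory Num.Theory.
Import numFieldNormedType.Exports.
Local Open Scope classical_set_scope.
Local Open Scope ring_scope.

Definition simple_graph (T : finType) (adj : rel T) :=
  symmetric adj /\ irreflexive adj.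

Definition regular (T : finType) (adj : rel T) (d : nat) :=
  forall v, #|[set w | adj v w]| = d.

Definition uniform_map (T2 T1 : finType) (adj2 : rel T2) (adj1 : rel T1)
  (f : T2 -> T1) (a b : nat) :=
  [/\ (forall u v, adj2 u v -> adj1 (f u) (f v)),
      (forall w, #|[set u | f u == w]| = a) &
      (forall v w, adj1 (f v) w -> #|[set u | adj2 v u && (f u == w)]| = b)].

(* A distribution on R^m is represented by its values on subsets of    *)
(* 'rV[R]_m (only Borel sets matter).                                  *)
Section Distances.
Variable R : realType.

Definition eucl_dist m (x y : 'rV[R]_m) : R :=
  Num.sqrt (\sum_(j < m) (x ord0 j - y ord0 j) ^+ 2).

Definition eps_nbhd m (e : R) (E : set 'rV[R]_m) : set 'rV[R]_m :=
  [set y | exists2 x, E x & eucl_dist x y < e].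

Definition borel_set m (E : set 'rV[R]_m) : Prop :=
  <<s [set U : set 'rV[R]_m | open U] >> E.

Definition levy_prokhorov m (P Q : set 'rV[R]_m -> R) : R :=
  inf [set e : R | 0 < e /\
        forall E, borel_set E ->
          P E <= Q (eps_nbhd e E) + e /\ Q E <= P (eps_nbhd e E) + e].

Definition hausdorff m (X Y : set (set 'rV[R]_m -> R)) : R :=
  Num.max (sup [set inf [set levy_prokhorov P Q | Q in Y] | P in X])
          (sup [set inf [set levy_prokhorov P Q | P in X] | Q in Y]).

Definition joint k (v vB : 'I_k -> R) : 'rV[R]_(k + k) :=
  row_mx (\row_j v j) (\row_j vB j).

Definition Sk_fin k N (B : ('I_N -> R) -> ('I_N -> R))
  : set (set 'rV[R]_(k + k) -> R) :=
  [set (fun E => #|[set i : 'I_N |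
          `[< E (joint (fun j => v j i) (fun j => B (v j) i)) >]]|%:R / N%:R)
   | v in [set v : 'I_k -> 'I_N -> R | forall j i, `|v j i| <= 1]].

(* S_k(B) for an operator B on a probability space (D, mu), where D is a
   measurable subset of T carrying all of the mass of mu *)
Definition Sk_meas dT (T : measurableType dT) (D : set T)
  (mu : {measure set T -> \bar R}) k (B : (T -> R) -> (T -> R))
  : set (set 'rV[R]_(k + k) -> R) :=
  [set (fun E => fine (mu (D `&`
          (fun x => joint (fun j => v j x) (fun j => B (v j) x)) @^-1` E)))
   | v in [set v : 'I_k -> T -> R |
           forall j, measurable_fun D (v j) /\
                     forall x, D x -> `|v j x| <= 1]].

Definition dM (X Y : forall k, set (set 'rV[R]_(k + k) -> R)) : R :=
  limn (fun K => \sum_(1 <= k < K) (2 ^- k) * hausdorff (X k) (Y k)).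

Definition dH_cauchy m (X : nat -> set (set 'rV[R]_m -> R)) :=
  forall e : R, 0 < e -> exists N, forall i j, (N <= i)%N -> (N <= j)%N ->
    hausdorff (X i) (X j) < e.

Definition adj_op N (adj : rel 'I_N) (d : R) (v : 'I_N -> R) : 'I_N -> R :=
  fun i => d^-1 * \sum_(j | adj j i) v j.

End Distances.

Definition seqT (n : nat -> nat) := forall i, 'I_(n i).+1.
HB.instance Definition _ n := gen_eqMixin (seqT n).
HB.instance Definition _ n := gen_choiceMixin (seqT n).

HB.instance Definition _ n := isPointed.Build (seqT n) (fun i => ord0).

Definition cylinders (n : nat -> nat) : set (set (seqT n)) :=
  [set C | exists i (w : 'I_(n i).+1), C = [set x : seqT n | x i = w]].

(* the product of the vertex sets, with the sigma-algebra generated by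
   cylinders (= Borel sigma-algebra of the product topology) *)
Notation towerT n := (g_sigma_algebraType (@cylinders n)).

Definition inv_limit (n : nat -> nat)
  (f : forall i, 'I_(n i.+1).+1 -> 'I_(n i).+1) : set (towerT n) :=
  [set x | forall i, f i (x i.+1) = x i].

Definition limit_op (R : realType) (n : nat -> nat) (V : set (towerT n))
  (nu : towerT n -> {measure set towerT n -> \bar R}) (g : towerT n -> R)
  : towerT n -> R :=
  fun x => fine (\int[nu x]_(y in V) (g y)%:E)%E.

Arguments Sk_fin {R} k {N} B.
Arguments Sk_meas {R dT T} D mu k B.
Arguments limit_op {R n} V nu g.
Arguments dM {R} X Y.
Arguments dH_cauchy {R m} X.
Arguments inv_limit {n} f.

(* Main.v *)
(** Write V for the inverse limit.  Pulling a function on V(G_i) back along the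
    projection shows that S_k(G_i) is contained in S_k(A).  Conversely, sets that
    depend on a single coordinate are dense in the sigma-algebra, so every test
    function on V is, up to a small error off a small set D, a function of the
    i-th coordinate.  Regularity makes mu stationary for the kernel nu, hence
    nu_x(D) is small for most x and the images under A stay close as well; this
    puts each element of S_k(A) near S_k(G_i) for large i.  The threshold can be
    chosen uniformly because the laws on [-1,1]^(2k) are totally bounded for the
    Levy-Prokhorov distance. *)

Require Import Defs.
From HB Require Import structures.
From mathcomp Require Import all_boot all_order all_algebra.
From mathcomp Require Import all_classical all_reals all_analysis.
From mathcomp Require Import measurable_realfun.
From mathcomp Require Import ring lra.
Import Order.TTheory GRing.Theory Num.Theory.
Import numFieldNormedType.Exports.
Local Open Scope classical_set_scope.
Local Open Scope ring_scope.
Set Implicit Arguments.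
Unset Strict Implicit.
Unset Printing Implicit Defensive.

(** The obstacle is that [nu x] may be singular to [mu], so an exceptional set that is negligible
    for [mu] can carry all the mass of a given [nu x]; approximating a test function therefore says
    nothing pointwise about its image. Control on average comes from each level: the random walk on
    a regular graph has a doubly stochastic matrix, and this identity passes to the limit by a
    Dynkin argument. Finite profiles are rewritten as laws of random vectors on V itself. Both sides
    then live on one probability space, and closeness off a small set bounds the distance of their
    laws without constructing a coupling. The level obtained for one test function depends on that
    function, and distances of laws do not see which function produced them. Grouping laws by a
    finite signature, with one approximated representative per group, removes the dependence at the
    price of one triangle inequality, which is proved for the relation [lp_close] and not for the
    infimum. *)

(** * Euclidean neighbourhoods, Levy-Prokhorov closeness and Hausdorff bounds *)

Section LevyProkhorov.
Context {R : realType} {m : nat}.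
Implicit Types (x y z : 'rV[R]_m) (P Q S : set 'rV[R]_m -> R).

Lemma eucl_dist_lt x y (e : R) : 0 < e ->
  (eucl_dist x y < e) = (\sum_(j < m) (x ord0 j - y ord0 j) ^+ 2 < e ^+ 2).
Proof.
move=> e0; rewrite /eucl_dist; set s := (\sum_(j < m) _).
have s0 : 0 <= s by apply: sumr_ge0 => j _; rewrite sqr_ge0.
by rewrite -{2}(sqr_sqrtr s0) ltr_pXn2r// nnegrE ?sqrtr_ge0// ltW.
Qed.

(** The divisor [m.+1] is generous: m < (m+1)^2 makes the inequality strict and covers m = 0. *)
Lemma eucl_dist_coord x y (e : R) : 0 < e ->
  (forall j, `|x ord0 j - y ord0 j| <= e / m.+1%:R) -> eucl_dist x y < e.
Proof.
move=> e0 h; rewrite eucl_dist_lt//.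
have m0 : 0 < m.+1%:R :> R by rewrite ltr0n.
have r0 : 0 <= e / m.+1%:R by rewrite divr_ge0 ?ltW.
apply: (@le_lt_trans _ _ (\sum_(j < m) (e / m.+1%:R) ^+ 2)).
  apply: ler_sum => j _; rewrite -real_normK ?num_real//.
  by rewrite ler_sqr ?nnegrE.
rewrite sumr_const card_ord -[_ *+ m]mulr_natl expr_div_n mulrA.
rewrite ltr_pdivrMr ?exprn_gt0//.
rewrite mulrC ltr_pM2l ?exprn_gt0// -natrX ltr_nat.
by rewrite (leq_trans (ltnSn m))// expnS expn1 leq_pmulr.
Qed.

(* The factor 2 is not sharp, but it spares the Cauchy-Schwarz inequality. *)
Lemma eucl_dist_quasi_triangle x y z (e1 e2 : R) : 0 < e1 -> 0 < e2 ->
  eucl_dist x y < e1 -> eucl_dist y z < e2 -> eucl_dist x z < 2 * (e1 + e2).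
Proof.
move=> e10 e20; rewrite !eucl_dist_lt ?mulr_gt0 ?addr_gt0// => h1 h2.
apply: (@le_lt_trans _ _ (2 * (e1 ^+ 2 + e2 ^+ 2))); last first.
  by rewrite !expr2; nra.
apply: (@le_trans _ _ (2 * (\sum_(j < m) (x ord0 j - y ord0 j) ^+ 2 +
   \sum_(j < m) (y ord0 j - z ord0 j) ^+ 2))); last by lra.
rewrite -big_split mulr_sumr; apply: ler_sum => j _ /=.
set a := x _ _; set b := y _ _; set c := z _ _.
have := sqr_ge0 ((a - b) - (b - c)); rewrite !expr2; nra.
Qed.

(** The condition under the infimum of [levy_prokhorov]. Unlike a bound on the infimum, it can be
    chained directly. *)
Definition lp_close (e : R) P Q := forall E, borel_set E ->
  P E <= Q (eps_nbhd e E) + e /\ Q E <= P (eps_nbhd e E) + e.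

Lemma lp_close_sym e P Q : lp_close e P Q -> lp_close e Q P.
Proof. by move=> h E /h[]. Qed.

Lemma levy_prokhorov_ge0 P Q : 0 <= levy_prokhorov P Q.
Proof.
rewrite /levy_prokhorov; set S := (X in inf X).
have [Sn|Sn] := pselect (S !=set0); first by apply: lb_le_inf => // e [/ltW].
by rewrite inf_out// => -[].
Qed.

Lemma levy_prokhorov_le e P Q : 0 < e -> lp_close e P Q ->
  levy_prokhorov P Q <= e.
Proof. by move=> e0 h; apply: ge_inf => //; exists 0 => r [/ltW]. Qed.

(** The topology of ['rV[R]_m] comes from the maximum norm, so Euclidean balls are shown open as
    preimages of half-lines under a continuous polynomial. *)
Lemma open_eps_nbhd (e : R) (E : set 'rV[R]_m) : 0 < e -> open (eps_nbhd e E).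
Proof.
move=> e0.
have -> : eps_nbhd e E = \bigcup_(x in E) [set y | eucl_dist x y < e].
  by apply/seteqP; split => y /= [x Ex xy]; exists x.
apply: bigcup_open => x _.
have c : continuous (fun y : 'rV[R]_m => \sum_(j < m) (x ord0 j - y ord0 j) ^+ 2).
  apply: continuous_big => [|j _ y]; first exact: add_continuous.
  have h : (fun z : 'rV[R]_m => x ord0 j - z ord0 j) @ y --> x ord0 j - y ord0 j.
    exact: (cvgB (cvg_cst (x ord0 j)) (@coord_continuous R 1 m ord0 j y)).
  by rewrite /continuous_at expr2; under eq_fun do rewrite expr2; exact: (cvgM h h).
have -> : [set y | eucl_dist x y < e] = (fun y : 'rV[R]_m =>
    \sum_(j < m) (x ord0 j - y ord0 j) ^+ 2) @^-1` [set t | t < e ^+ 2].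
  by apply/seteqP; split => y /=; rewrite eucl_dist_lt.
by apply: open_comp => // y _; exact: c.
Qed.

Lemma borel_eps_nbhd (e : R) (E : set 'rV[R]_m) : 0 < e -> borel_set (eps_nbhd e E).
Proof. by move=> e0; apply: sub_sigma_algebra; exact: open_eps_nbhd. Qed.

(** Points of S_k are bare set functions; this is the one trait of a measure that reflexivity and
    the triangle inequality use. *)
Definition borel_monotone P :=
  forall A B, borel_set A -> borel_set B -> A `<=` B -> P A <= P B.

Lemma lp_close_refl (e : R) P : 0 < e -> borel_monotone P -> lp_close e P P.
Proof.
move=> e0 mP E bE; suff h : P E <= P (eps_nbhd e E) by split; lra.
apply: mP => //; first exact: borel_eps_nbhd.
move=> x Ex; exists x => //; rewrite eucl_dist_lt// big1 ?exprn_gt0// => j _.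
by rewrite subrr expr0n.
Qed.

(** An iterated neighbourhood lies in the one of radius 2(e1 + e2), and monotonicity of the two
    outer set functions absorbs the inclusion. *)
Lemma lp_close_trans (e1 e2 : R) P Q S : 0 < e1 -> 0 < e2 ->
  borel_monotone P -> borel_monotone S ->
  lp_close e1 P Q -> lp_close e2 Q S -> lp_close (2 * (e1 + e2)) P S.
Proof.
move=> e10 e20 mP mS PQ QS E mE.
have e3 : 0 < 2 * (e1 + e2) by rewrite mulr_gt0 ?addr_gt0.
have sub1 : eps_nbhd e2 (eps_nbhd e1 E) `<=` eps_nbhd (2 * (e1 + e2)) E.
  by move=> z [y [x Ex xy] yz]; exists x => //; apply: eucl_dist_quasi_triangle xy yz.
have sub2 : eps_nbhd e1 (eps_nbhd e2 E) `<=` eps_nbhd (2 * (e1 + e2)) E.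
  move=> z [y [x Ex xy] yz]; exists x => //; rewrite [e1 + _]addrC.
  exact: eucl_dist_quasi_triangle xy yz.
have [h1 _] := PQ _ mE; have [_ h2] := QS _ mE.
have [h3 _] := QS _ (borel_eps_nbhd E e10).
have [_ h4] := PQ _ (borel_eps_nbhd E e20).
have h5 := mS _ _ (borel_eps_nbhd _ e20) (borel_eps_nbhd _ e3) sub1.
have h6 := mP _ _ (borel_eps_nbhd _ e10) (borel_eps_nbhd _ e3) sub2.
split; lra.
Qed.

Lemma hausdorff_ge0 (X Y : set (set 'rV[R]_m -> R)) : 0 <= hausdorff X Y.
Proof.
have inf0 (A : set R) : (forall a, A a -> 0 <= a) -> 0 <= inf A.
  move=> h; have [An|An] := pselect (A !=set0); first exact: lb_le_inf.
  by rewrite inf_out// => -[].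
rewrite /hausdorff le_max; apply/orP; left; set A := (X in sup X).
have [hA|hA] := pselect (has_sup A); last by rewrite sup_out.
case: (hA) => -[a Aa] _; apply: (@le_trans _ _ a); last exact: sup_upper_bound.
case: Aa => P _ <-; apply: inf0 => _ [Q _ <-]; exact: levy_prokhorov_ge0.
Qed.

Lemma hausdorff_le (e : R) (X Y : set (set 'rV[R]_m -> R)) : 0 <= e ->
  (forall P, X P -> exists2 Q, Y Q & levy_prokhorov P Q <= e) ->
  (forall Q, Y Q -> exists2 P, X P & levy_prokhorov P Q <= e) ->
  hausdorff X Y <= e.
Proof.
move=> e0 h1 h2.
(* The supremum of the empty set is 0 by default, which is where [0 <= e] enters. *)
have sup_le (A : set R) : (forall a, A a -> a <= e) -> sup A <= e.
  move=> h; have [An|An] := pselect (A !=set0); first exact: ge_sup.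
  by rewrite sup_out// => -[].
rewrite /hausdorff ge_max; apply/andP; split; apply: sup_le => _ [P XP <-].
  have [Q YQ PQ] := h1 _ XP; apply: le_trans PQ; apply: ge_inf; last by exists Q.
  by exists 0 => _ [? _ <-]; exact: levy_prokhorov_ge0.
have [Q YQ PQ] := h2 _ XP; apply: le_trans PQ; apply: ge_inf; last by exists Q.
by exists 0 => _ [? _ <-]; exact: levy_prokhorov_ge0.
Qed.

End LevyProkhorov.

(** * Measures of unions indexed by a finite type *)

Section FiniteUnions.
Context {d : measure_display} {T : measurableType d} {R : realType}.
Variable mu : {measure set T -> \bar R}.

Lemma bigcup_finE (I : finType) (P : pred I) (A : I -> set T) :
  \bigcup_(i in [set i | P i]) A i = \big[setU/set0]_(i | P i) A i.
Proof.
rewrite -big_filter -bigcup_seq; apply: eq_bigcupl; split=> i /=.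
  by move=> Pi; rewrite mem_filter Pi mem_index_enum.
by rewrite mem_filter => /andP[].
Qed.

Lemma measurable_bigcup_fin (I : finType) (P : pred I) (A : I -> set T) :
  (forall i, measurable (A i)) -> measurable (\bigcup_(i in [set i | P i]) A i).
Proof. by move=> mA; rewrite bigcup_finE; apply: bigsetU_measurable. Qed.

Lemma measure_bigcup_fin (I : finType) (P : pred I) (A : I -> set T) :
  (forall i, measurable (A i)) -> trivIset setT A ->
  mu (\bigcup_(i in [set i | P i]) A i) = (\sum_(i | P i) mu (A i))%E.
Proof.
move=> mA tA; rewrite bigcup_finE -big_filter -[RHS]big_filter.
have : uniq [seq i <- index_enum I | P i] by rewrite filter_uniq ?index_enum_uniq.
elim: [seq i <- _ | _] => [|i s ih] /=; first by rewrite !big_nil measure0.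
move=> /andP[ins us]; rewrite !big_cons -ih// measureU//.
  exact: bigsetU_measurable.
apply/seteqP; split => // x [Aix]; rewrite -bigcup_seq => -[j /= js Ajx].
have ij : i = j by apply: (tA i j) => //; exists x.
by rewrite ij js in ins.
Qed.

Lemma le_measure_bigcup_fin (I : finType) (P : pred I) (A : I -> set T) :
  (forall i, measurable (A i)) ->
  (mu (\bigcup_(i in [set i | P i]) A i) <= \sum_(i | P i) mu (A i))%E.
Proof.
move=> mA; rewrite bigcup_finE -big_filter -[leRHS]big_filter.
elim: [seq i <- _ | _] => [|i s ih]; first by rewrite !big_nil measure0.
rewrite !big_cons; apply: le_trans (measureU2 _ _ _) _ => //.
  exact: bigsetU_measurable.
exact: leeD2l.
Qed.

End FiniteUnions.

(** * Laws of random vectors on a measurable subset *)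

Section Laws.
Context {d : measure_display} {T : measurableType d} {R : realType} {m : nat}.
Implicit Types (V : set T) (X Y : T -> 'rV[R]_m).

Definition coord_measurable V X :=
  forall j, measurable_fun V (fun x => X x ord0 j).

Lemma measurable_preimage_box V X (B : 'I_m -> set R) : measurable V ->
  coord_measurable V X -> (forall j, measurable (B j)) ->
  measurable (V `&` X @^-1` [set y | forall j, B j (y ord0 j)]).
Proof.
move=> mV mX mB.
rewrite (_ : _ `&` _ = V `\` \bigcup_(j in [set j | true])
    (V `&` (fun x => X x ord0 j) @^-1` (~` B j))).
  apply: measurableD => //; apply: measurable_bigcup_fin => j.
  by apply: mX => //; exact: measurableC.
apply/seteqP; split => x [Vx h]; split => //.
  by move=> [j _ [_]]; apply; exact: h.
by move=> j; apply: contrapT => nB; apply: h; exists j.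
Qed.

(** Sets with measurable preimage form a sigma-algebra, so open sets suffice; an open set is the
    countable union of the boxes of rational centre and radius 1/(k+1) that it contains. *)
Lemma measurable_preimage_borel V X (E : set 'rV[R]_m) : measurable V ->
  coord_measurable V X -> borel_set E -> measurable (V `&` X @^-1` E).
Proof.
move=> mV mX; apply: (smallest_sub (C := sigma_algebra setT)
  (X := [set E | measurable (V `&` X @^-1` E)])).
  split => /=.
  - by rewrite preimage_set0 setI0.
  - move=> A mA; rewrite setTD preimage_setC.
    rewrite (_ : V `&` _ = V `\` (V `&` X @^-1` A)); first exact: measurableD.
    by rewrite setDIr setDv set0U setDE.
  - move=> F mF; rewrite preimage_bigcup setI_bigcupr.
    exact: bigcupT_measurable.
move=> U oU /=.
pose box (qk : 'rV[rat]_m * nat) := [set y : 'rV[R]_m |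
  forall j, ball (ratr (qk.1 ord0 j) : R) qk.2.+1%:R^-1 (y ord0 j)].
rewrite (_ : V `&` _ = \bigcup_qk
    if `[< box qk `<=` U >] then V `&` X @^-1` box qk else set0).
  apply: countable_bigcupT_measurable => [|qk]; first exact: countableP.
  case: ifP => _; last exact: measurable0.
  pose B j : set R := ball (ratr (qk.1 ord0 j) : R) qk.2.+1%:R^-1.
  apply: (measurable_preimage_box (B := B)) => // j.
  exact: measurable_ball.
apply/seteqP; split; last first.
  by move=> x [qk _]; case: asboolP => // sub [Vx bx]; split => //; exact: sub.
move=> x [Vx Ux].
have /nbhs_ballP[e /= e0 eU] : nbhs (X x) U by apply: open_nbhs_nbhs.
(* [X x] and every point of the box are within this radius of the centre, so the box stays in the
   ball of radius [e]. *)
have [k ke] : exists k : nat, k.+1%:R^-1 < e / 2.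
  have e20 : 0 < e / 2 by rewrite divr_gt0.
  have [k _ /(_ k (leqnn k))] := near_infty_natSinv_lt (PosNum e20).
  by exists k.
have k0 : 0 < k.+1%:R^-1 :> R by rewrite invr_gt0.
have /choice[q hq] : forall j : 'I_m, exists q : rat,
    ball (ratr q : R) k.+1%:R^-1 (X x ord0 j).
  move=> j; have [|q] := @rat_in_itvoo R (X x ord0 j) (X x ord0 j + k.+1%:R^-1).
    by rewrite ltrDl.
  rewrite in_itv/= => /andP[q1 q2]; exists q; rewrite /ball/=.
  by rewrite gtr0_norm ?subr_gt0// ltrBlDl.
exists (\row_j q j, k) => //.
case: asboolP => [_|[]]; first by split => // j; rewrite mxE.
move=> y yb; apply: eU; split => // i j; rewrite ord1.
have := yb j; have := hq j; rewrite mxE /ball/= => h1 h2.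
rewrite [e]splitr (le_lt_trans (ler_distD (ratr (q j)) _ _))// ltrD//.
  by rewrite distrC (lt_trans h1).
exact: lt_trans h2 ke.
Qed.

Variables (mu : probability T R) (V : set T).
Hypothesis mV : measurable V.

Definition law X (E : set 'rV[R]_m) : R := fine (mu (V `&` X @^-1` E)).

Let fin (A : set T) : measurable A -> mu A \is a fin_num.
Proof. exact: fin_num_measure. Qed.

Lemma law_ge0 X E : 0 <= law X E.
Proof. by rewrite fine_ge0. Qed.

Lemma law_monotone X : coord_measurable V X -> borel_monotone (law X).
Proof.
move=> mX A B bA bB AB.
have mA := measurable_preimage_borel mV mX bA.
have mB := measurable_preimage_borel mV mX bB.
rewrite /law fine_le ?fin// le_measure ?inE//.
by apply: setIS; exact: preimage_subset.
Qed.

Lemma law_le1 X E : coord_measurable V X -> borel_set E -> law X E <= 1.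
Proof.
move=> mX bE; have mE := measurable_preimage_borel mV mX bE.
by rewrite /law -lee_fin fineK ?fin// probability_le1.
Qed.

(** The slack 1 dominates any mass. This uniform bound controls the tail of the series [dM]. *)
Lemma levy_prokhorov_law_le1 X Y :
  coord_measurable V X -> coord_measurable V Y ->
  levy_prokhorov (law X) (law Y) <= 1.
Proof.
move=> mX mY; apply: levy_prokhorov_le => // E bE.
by split; apply: le_trans (law_le1 _ bE) _ => //; rewrite lerDr law_ge0.
Qed.

(** The pair (X, Y) is itself a coupling: the event that X is in E is contained in [D] together with
    the event that Y is in the [e]-neighbourhood of E. *)
Lemma lp_close_coupling (e : R) X Y (D : set T) : 0 < e ->
  coord_measurable V X -> coord_measurable V Y -> measurable D ->
  (mu D <= e%:E)%E -> (forall x, V x -> ~ D x -> eucl_dist (X x) (Y x) < e) ->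
  lp_close e (law X) (law Y).
Proof.
move=> e0.
have half X' Y' E : coord_measurable V X' -> coord_measurable V Y' ->
    measurable D -> (mu D <= e%:E)%E ->
    (forall x, V x -> ~ D x -> eucl_dist (X' x) (Y' x) < e) -> borel_set E ->
    law X' E <= law Y' (eps_nbhd e E) + e.
  move=> mX mY mD De h bE.
  have mA := measurable_preimage_borel mV mX bE.
  have mB := measurable_preimage_borel mV mY (borel_eps_nbhd E e0).
  rewrite -lee_fin EFinD !fineK ?fin//.
  apply: (@le_trans _ _ (mu ((V `&` Y' @^-1` eps_nbhd e E) `|` D))).
    rewrite le_measure ?inE//; first exact: measurableU.
    move=> x [Vx EX]; have [Dx|nD] := pselect (D x); [by right|left].
    by split => //; exists (X' x) => //; exact: h.
  by apply: le_trans (measureU2 _ _ _) _ => //; exact: leeD2l.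
move=> mX mY mD De h E bE; split; first exact: half.
apply: half => // x Vx nD; rewrite /eucl_dist.
under eq_bigr do rewrite -sqrrN opprB.
exact: h.
Qed.

End Laws.

(** * Total boundedness of laws on a cube *)

Section TotalBoundedness.
Context {d : measure_display} {T : measurableType d} {R : realType} {m : nat}.
Variables (mu : probability T R) (V : set T).
Hypothesis mV : measurable V.
Implicit Types (X Y : T -> 'rV[R]_m).

Lemma ex_succn_gt (x : R) : exists M : nat, x < M.+1%:R.
Proof. by exists (Num.truncn x); exact: truncnS_gt. Qed.

Lemma truncn_eq_dist (x y : R) : 0 <= x -> 0 <= y ->
  Num.truncn x = Num.truncn y -> `|x - y| <= 1.
Proof.
move=> /truncn_itv/andP[x1 x2] /truncn_itv/andP[y1 y2] xy.
rewrite xy in x1 x2; rewrite -natr1 in x2 y2.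
by rewrite ler_norml; apply/andP; split; lra.
Qed.

(** The affine map of [-1,1] onto [0, M+1], which turns grid intervals into unit intervals between
    integers. *)
Definition grid_scale (M : nat) (t : R) : R := (t + 1) * M.+1%:R / 2.

Lemma grid_scaleB M (s t : R) :
  s - t = (grid_scale M s - grid_scale M t) * (2 / M.+1%:R).
Proof. by rewrite /grid_scale; field. Qed.

Lemma grid_scale_itv M (t : R) : `|t| <= 1 -> 0 <= grid_scale M t <= M.+1%:R.
Proof.
rewrite ler_norml /grid_scale => /andP[t1 t2].
have M0 : 0 < M.+1%:R :> R by rewrite ltr0n.
by apply/andP; split; nra.
Qed.

Definition grid_itv (M a : nat) : set R :=
  [set t | a%:R <= grid_scale M t < a.+1%:R].

Lemma measurable_grid_itv M a : measurable (grid_itv M a).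
Proof.
have M0 : 0 < M.+1%:R :> R by rewrite ltr0n.
rewrite (_ : grid_itv M a =
    [set` `[2 * a%:R / M.+1%:R - 1, 2 * a.+1%:R / M.+1%:R - 1[%R]).
  exact: measurable_itv.
apply/seteqP; split => t; rewrite /grid_itv/grid_scale /= in_itv/=.
all: rewrite lerBlDr ltrBrDr ler_pdivrMr// ltr_pdivlMr// => /andP[a1 a2].
all: by apply/andP; split; lra.
Qed.

Lemma grid_itv_inj M (a b : nat) t : grid_itv M a t -> grid_itv M b t -> a = b.
Proof.
move=> /andP[a1 a2] /andP[b1 b2]; apply/eqP; rewrite eqn_leq.
have := le_lt_trans a1 b2; have := le_lt_trans b1 a2.
by rewrite !ltr_nat !ltnS => -> ->.
Qed.

Lemma grid_itv_dist M (a : nat) s t : grid_itv M a s -> grid_itv M a t ->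
  `|s - t| <= 2 / M.+1%:R.
Proof.
rewrite /grid_itv/= -natr1 => /andP[a1 a2] /andP[b1 b2].
rewrite (grid_scaleB M) normrM (@ger0_norm _ (2 / _))// ler_piMl//.
by rewrite ler_norml; apply/andP; split; lra.
Qed.

(** The intervals are half-open and the endpoint 1 has scale exactly M+1, so index M+1 is needed as
    well. *)
Definition cell M (c : {ffun 'I_m -> 'I_M.+2}) : set 'rV[R]_m :=
  [set y | forall j, grid_itv M (c j) (y ord0 j)].

(** The signature of a law is the list of its cell masses rounded to multiples of 1/(L+1). A Borel
    set is covered by the cells that meet it, these cells stay in its [e]-neighbourhood, and equal
    signatures make their total masses differ by at most [e]. *)
Lemma law_totally_bounded (e : R) : 0 < e ->
  exists (F : finType) (sig : (set 'rV[R]_m -> R) -> F), forall X Y,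
  coord_measurable V X -> coord_measurable V Y ->
  (forall x, V x -> forall j, `|X x ord0 j| <= 1) ->
  (forall x, V x -> forall j, `|Y x ord0 j| <= 1) ->
  sig (law mu V X) = sig (law mu V Y) -> lp_close e (law mu V X) (law mu V Y).
Proof.
move=> e0.
(* [M] brings the cell side 2/(M+1) below the coordinate bound of [eucl_dist_coord]; [L] keeps the
   sum of the |C| rounding errors below [e]. *)
have [M hM] := ex_succn_gt (2 / (e / m.+1%:R)).
pose C := {ffun 'I_m -> 'I_M.+2}.
have [L hL] := ex_succn_gt (#|C|%:R / e).
exists {ffun C -> 'I_L.+2}.
exists (fun P => [ffun c => inord (Num.truncn (P (@cell M c) * L.+1%:R))]).
have M0 : 0 < M.+1%:R :> R by rewrite ltr0n.
have L0 : 0 < L.+1%:R :> R by rewrite ltr0n.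
have m0 : 0 < m.+1%:R :> R by rewrite ltr0n.
have Me : 2 / M.+1%:R <= e / m.+1%:R.
  by rewrite ler_pdivrMr// mulrC -ler_pdivrMr ?divr_gt0// ltW.
have Le : #|C|%:R / L.+1%:R <= e.
  by rewrite ler_pdivrMr// mulrC -ler_pdivrMr// ltW.
have mcell X c : coord_measurable V X -> measurable (V `&` X @^-1` @cell M c).
  move=> mX; apply: (measurable_preimage_box (B := fun j => grid_itv M (c j)) mV mX).
  by move=> j; exact: measurable_grid_itv.
have fin (A : set T) : measurable A -> mu A \is a fin_num by exact: fin_num_measure.
have lawE X c : coord_measurable V X ->
    (law mu V X (@cell M c))%:E = mu (V `&` X @^-1` @cell M c).
  by move=> mX; rewrite fineK// fin//; exact: mcell.
have half X Y E : coord_measurable V X -> coord_measurable V Y ->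
    (forall x, V x -> forall j, `|X x ord0 j| <= 1) ->
    (forall c, law mu V X (@cell M c) <= law mu V Y (@cell M c) + L.+1%:R^-1) ->
    borel_set E -> law mu V X E <= law mu V Y (eps_nbhd e E) + e.
  move=> mX mY bX h bE.
  pose meets (c : C) := `[< exists2 y, E y & @cell M c y >].
  have mB := measurable_preimage_borel mV mY (borel_eps_nbhd E e0).
  have mA := measurable_preimage_borel mV mX bE.
  have tcell Z : trivIset setT (fun c : C => V `&` Z @^-1` @cell M c).
    move=> c c' _ _ [x [[_ cx] [_ c'x]]]; apply/ffunP => j; apply: val_inj.
    exact: grid_itv_inj (cx j) (c'x j).
  apply: (@le_trans _ _ (\sum_(c | meets c) law mu V X (@cell M c))).
    rewrite -lee_fin fineK ?fin// -sumEFin.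
    under eq_bigr do rewrite lawE//.
    rewrite -measure_bigcup_fin//; last by move=> c; exact: mcell.
    rewrite le_measure ?inE//.
      by apply: measurable_bigcup_fin => c; exact: mcell.
    move=> x [Vx Ex].
    pose c : C := [ffun j => inord (Num.truncn (grid_scale M (X x ord0 j)))].
    have cellX : @cell M c (X x).
      move=> j; rewrite ffunE /grid_itv/=.
      have /andP[g0 gM] := grid_scale_itv M (bX _ Vx j).
      rewrite inordK; first exact: truncn_itv.
      by rewrite ltnS -(ler_nat R) (le_trans _ gM)// truncn_le.
    by exists c => //; apply/asboolP; exists (X x).
  apply: (@le_trans _ _ (\sum_(c | meets c) law mu V Y (@cell M c) + e)).
    apply: (@le_trans _ _ (\sum_(c | meets c) (law mu V Y (@cell M c) + L.+1%:R^-1))).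
      by apply: ler_sum => c _; exact: h.
    rewrite big_split /= lerD2l sumr_const (le_trans _ Le)// -[leLHS]mulr_natl//.
    by rewrite ler_pM2r ?invr_gt0// ler_nat max_card.
  rewrite lerD2r -lee_fin fineK ?fin// -sumEFin.
  under eq_bigr do rewrite lawE//.
  rewrite -measure_bigcup_fin//; last by move=> c; exact: mcell.
  rewrite le_measure ?inE//.
    by apply: measurable_bigcup_fin => c; exact: mcell.
  move=> x [c /asboolP[y Ey cy] [Vx cx]]; split => //; exists y => //.
  apply: eucl_dist_coord => // j; apply: le_trans Me.
  exact: grid_itv_dist (cy j) (cx j).
have sig_close X Y c : coord_measurable V X -> coord_measurable V Y ->
    Num.truncn (law mu V X (@cell M c) * L.+1%:R) =
    Num.truncn (law mu V Y (@cell M c) * L.+1%:R) ->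
    law mu V X (@cell M c) <= law mu V Y (@cell M c) + L.+1%:R^-1.
  move=> mX mY /truncn_eq_dist; rewrite !mulr_ge0 ?law_ge0// => /(_ isT isT).
  rewrite -mulrBl normrM (@gtr0_norm _ L.+1%:R)// -ler_pdivlMr// mul1r => h.
  by rewrite -lerBlDl (le_trans (ler_norm _)).
move=> X Y mX mY bX bY eXY E bE.
have trE c : Num.truncn (law mu V X (@cell M c) * L.+1%:R) =
    Num.truncn (law mu V Y (@cell M c) * L.+1%:R).
  have trunc_le Z : coord_measurable V Z ->
      (Num.truncn (law mu V Z (@cell M c) * L.+1%:R) < L.+2)%N.
    move=> mZ; rewrite ltnS -(ler_nat R).
    apply: (@le_trans _ _ (law mu V Z (@cell M c) * L.+1%:R)).
      by rewrite truncn_le mulr_ge0 ?law_ge0.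
    rewrite ler_piMl// -lee_fin fineK ?fin ?probability_le1//; exact: mcell.
  have /ffunP/(_ c) := eXY; rewrite !ffunE => /(congr1 val) /=.
  by rewrite !inordK ?trunc_le.
by split; apply: half => // c; apply: sig_close.
Qed.

End TotalBoundedness.

Lemma probability_bounded_integrable d (T : measurableType d) (R : realType)
  (p : probability T R) (V : set T) (g : T -> R) (C : R) :
  measurable V -> measurable_fun V g -> (forall x, V x -> `|g x| <= C) ->
  p.-integrable V (fun x => (g x)%:E).
Proof.
move=> mV mg gC; apply: (@le_integrable _ _ _ p _ mV _ (EFin \o cst C)).
- exact/measurable_EFinP.
- by move=> x Vx; rewrite !abse_EFin lee_fin (le_trans (gC _ Vx))// ler_norm.
- exact: finite_measure_integrable_cst.
Qed.

(** * Cylinder sets and functions of one coordinate *)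

Section Levels.
Context {R : realType} {n : nat -> nat}.
Variable f : forall i, 'I_(n i.+1).+1 -> 'I_(n i).+1.
Notation V := (inv_limit f).
Implicit Types (p : probability (towerT n) R).

Lemma measurable_level i (P : set 'I_(n i).+1) :
  measurable [set x : towerT n | P (x i)].
Proof.
rewrite (_ : [set x | _] =
    \bigcup_(w in [set w | `[< P w >]]) [set x : towerT n | x i = w]).
  apply: measurable_bigcup_fin => w.
  by apply: sub_sigma_algebra; exists i, w.
apply/seteqP; split => x /=.
  by move=> Px; exists (x i) => //; apply/asboolP.
by move=> [w /asboolP Pw ->].
Qed.

Lemma measurable_inv_limit : measurable V.
Proof.
rewrite (_ : V = \bigcap_i [set x : towerT n | f (x i.+1) = x i]); last first.
  by apply/seteqP; split => x h i => [_|]; apply: h.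
apply: bigcapT_measurable => i.
rewrite (_ : [set x | _] = \bigcup_(w in [set w | true])
   ([set x : towerT n | x i.+1 = w] `&` [set x : towerT n | x i = f w])).
  apply: measurable_bigcup_fin => w; apply: measurableI;
  exact: (measurable_level (fun v => v = _)).
apply/seteqP; split => x /=.
  by move=> fx; exists (x i.+1).
by move=> [w _ [<- ->]].
Qed.

Lemma measurable_fun_level d' (T' : measurableType d') i (g : 'I_(n i).+1 -> T') :
  measurable_fun V (fun x : towerT n => g (x i)).
Proof.
move=> _ Y mY; apply: measurableI; first exact: measurable_inv_limit.
exact: (measurable_level (fun w => Y (g w))).
Qed.

Lemma probability_setI_lim p (A : set (towerT n)) :
  p V = 1%E -> measurable A -> p (A `&` V) = p A.
Proof.
move=> pV mA; have mV := measurable_inv_limit.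
apply/eqP; rewrite eq_le le_measure ?inE//=; last exact: measurableI.
apply: (@le_trans _ _ (p (A `&` V) + p (~` V))%E).
  apply: le_trans (measureU2 _ _ _); last exact: measurableC.
    rewrite le_measure ?inE//; last first.
      by move=> x Ax; have [Vx|nVx] := pselect (V x); [left|right].
    by apply: measurableU; [exact: measurableI|exact: measurableC].
  exact: measurableI.
by rewrite probability_setC// pV subee// adde0.
Qed.

Lemma probability_level p i (P : set 'I_(n i).+1) (g : 'I_(n i).+1 -> R) :
  p V = 1%E -> (forall w, p [set x : towerT n | x i = w] = (g w)%:E) ->
  p [set x : towerT n | P (x i)] = (\sum_(w | `[< P w >]) g w)%:E.
Proof.
move=> pV pg.
rewrite (_ : [set x | _] =
    \bigcup_(w in [set w | `[< P w >]]) [set x : towerT n | x i = w]).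
  rewrite measure_bigcup_fin//.
  - by rewrite -sumEFin; apply: eq_bigr => w _; exact: pg.
  - by move=> w; exact: (measurable_level (fun v => v = w)).
  - by move=> w w' _ _ [x [/= <- <-]].
apply/seteqP; split => x /=.
  by move=> Px; exists (x i) => //; apply/asboolP.
by move=> [w /asboolP Pw ->].
Qed.

Lemma integral_level p i (g h : 'I_(n i).+1 -> R) :
  p V = 1%E -> (forall w, p [set x : towerT n | x i = w] = (g w)%:E) ->
  (\int[p]_(x in V) (h (x i))%:E = (\sum_w h w * g w)%:E)%E.
Proof.
move=> pV pg; have mV := measurable_inv_limit.
have ml w : measurable [set x : towerT n | x i = w].
  exact: (measurable_level (fun v => v = w)).
transitivity (\int[p]_(x in V)
    (\sum_w ((h w)%:E * (\1_[set x : towerT n | x i = w] x)%:E)))%E.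
  apply: eq_integral => x _; rewrite (bigD1 (x i))//= indicE mem_set// mule1.
  rewrite big1 ?adde0// => w wx; rewrite indicE memNset ?mule0// => /= xw.
  by rewrite xw eqxx in wx.
have int w : p.-integrable V (fun x => (\1_[set x : towerT n | x i = w] x)%:E).
  apply: (@probability_bounded_integrable _ _ _ _ _ _ 1) => //.
  by move=> x _; rewrite indicE; case: (_ \in _); rewrite ?normr1 ?normr0.
rewrite integral_sum//; last by move=> w; exact: integrableZl.
rewrite -sumEFin; apply: eq_bigr => w _.
rewrite integralZl// integral_indic// EFinM -pg muleC [in RHS]muleC.
by congr (_ * _)%E; exact: probability_setI_lim.
Qed.

End Levels.

(** * Stationarity of [mu] under the neighbour kernel *)

Section LimitOperator.
Context {R : realType} {n : nat -> nat}.
Variables (adj : forall i, rel 'I_(n i).+1)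
  (f : forall i, 'I_(n i.+1).+1 -> 'I_(n i).+1) (d : nat -> nat)
  (mu : probability (towerT n) R) (nu : towerT n -> probability (towerT n) R).
Notation V := (inv_limit f).
Hypotheses (adj_sym : forall i, symmetric (@adj i)) (d_gt0 : forall i, (0 < d i)%N)
  (adj_reg : forall i, regular (@adj i) (d i)) (mu_lim : mu V = 1%E)
  (mu_level : forall i (w : 'I_(n i).+1),
    mu [set x : towerT n | x i = w] = ((n i).+1%:R^-1)%:E)
  (nu_lim : forall x, V x -> nu x V = 1%E)
  (nu_level : forall x, V x -> forall i (w : 'I_(n i).+1),
    nu x [set y : towerT n | y i = w] = ((adj (x i) w)%:R / (d i)%:R)%:E).

Let mV : measurable V := measurable_inv_limit f.

(** Dependence on coordinate [i] alone, tested on V only. Taking [Y] to be [Prop] covers sets as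
    well as functions. *)
Definition level_fun (Y : Type) i (u : towerT n -> Y) :=
  forall x y, V x -> V y -> x i = y i -> u x = u y.

Lemma level_fun_le (Y : Type) i j (u : towerT n -> Y) : (i <= j)%N ->
  level_fun i u -> level_fun j u.
Proof.
move=> ij ui; rewrite -(subnK ij); elim: (j - i)%N => // k ih x y Vx Vy.
rewrite addSn => xy; apply: ih => //.
by rewrite -Vx -Vy xy.
Qed.

(** A cylinder missing V would be null since V has full mass, yet it has mass 1/(n_i + 1). *)
Lemma ex_lim_level i (w : 'I_(n i).+1) : exists2 x, V x & x i = w.
Proof.
apply: contrapT => h.
have : mu ([set x : towerT n | x i = w] `&` V) = 0%E.
  rewrite (_ : _ `&` _ = set0) ?measure0//.
  by apply/seteqP; split => x // [xw Vx]; apply: h; exists x.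
rewrite (probability_setI_lim mu_lim); last exact: (measurable_level (fun v => v = w)).
by rewrite mu_level => -[/eqP]; rewrite invr_eq0 pnatr_eq0.
Qed.

(** The second clause says that [g] takes only values of [u] on V, so bounds on [u] pass to [g]. *)
Lemma level_fun_factor (Y : Type) i (u : towerT n -> Y) : level_fun i u ->
  exists2 g : 'I_(n i).+1 -> Y, (forall x, V x -> u x = g (x i)) &
    forall w, exists2 x, V x & g w = u x.
Proof.
move=> hu.
have /choice[s hs] : forall w : 'I_(n i).+1, exists x, V x /\ x i = w.
  by move=> w; have [x] := ex_lim_level w; exists x.
exists (u \o s) => [x Vx|w] /=.
  by apply: hu; have [] := hs (x i).
by exists (s w) => //; have [] := hs w.
Qed.

(** The column sums of the walk matrix: symmetry turns them into row sums, which regularity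
    evaluates. *)
Lemma sum_adj i (w : 'I_(n i).+1) :
  \sum_v ((adj v w)%:R / (d i)%:R) = 1 :> R.
Proof.
rewrite -mulr_suml -natr_sum (_ : \sum_v _ = d i)%N ?divff ?pnatr_eq0 -?lt0n//.
rewrite -(adj_reg w) -sum1_card [RHS]big_mkcond /=; apply: eq_bigr => v _.
have -> : (v \in [set v | adj w v]) = adj w v by apply/idP/idP; rewrite inE.
by rewrite adj_sym; case: adj.
Qed.

Lemma level_set_factor i (B : set (towerT n)) : measurable B -> level_fun i B ->
  exists P : set 'I_(n i).+1, forall p : probability (towerT n) R, p V = 1%E ->
    p B = p [set x : towerT n | P (x i)].
Proof.
move=> mB /level_fun_factor[P hP _]; exists P => p pV.
rewrite -(probability_setI_lim pV mB).
rewrite -(probability_setI_lim pV (measurable_level P)).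
by congr (p _); apply/seteqP; split => x [/= h Vx]; split => //=; rewrite ?hP// -hP.
Qed.

(** Level sets are closed under intersection, by passing to the larger level, and generate the
    sigma-algebra, so Dynkin induction applies. For a level set the identity is a double sum
    evaluated by [sum_adj]. Measurability is carried along because the complement and union cases
    integrate [nu x B]. *)
Lemma nu_stationary (B : set (towerT n)) : measurable B ->
  measurable_fun V (fun x => nu x B) /\ (\int[mu]_(x in V) nu x B = mu B)%E.
Proof.
(* Measurability is required separately since [level_fun] leaves the part outside V free. *)
pose G := [set B : set (towerT n) | measurable B /\ exists i, level_fun i B].
pose P := [set B : set (towerT n) |
  measurable_fun V (fun x => nu x B) /\ (\int[mu]_(x in V) nu x B = mu B)%E].
have GE : measurable = <<s G>>.
  apply/seteqP; split => A.
    apply: sub_sigma_algebra2 => _ [i [w ->]]; split.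
      exact: (measurable_level (fun v => v = w)).
    by exists i => x y _ _ /= ->.
  apply: smallest_sub; first exact: sigma_algebra_measurable.
  by move=> C [].
rewrite GE; move: B; apply: (@dynkin_induction _ _ G P GE).
- move=> A B [mA [i Ai]] [mB [j Bj]]; split; first exact: measurableI.
  exists (maxn i j) => x y Vx Vy xy; rewrite /setI /=.
  congr and.
    exact: (level_fun_le (leq_maxl i j) Ai).
  exact: (level_fun_le (leq_maxr i j) Bj).
- split.
    rewrite (_ : (fun x => _) = cst 1%E); first exact: measurable_cst.
    by apply/funext => x; rewrite probability_setT.
  under eq_integral do rewrite probability_setT.
  rewrite integral_cst// mul1e probability_setT; exact: mu_lim.
- move=> B [mB [i Bi]].
  have [Q hQ] := level_set_factor mB Bi.
  pose g (v : 'I_(n i).+1) : R := \sum_(w | `[< Q w >]) ((adj v w)%:R / (d i)%:R).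
  have nuB x : V x -> nu x B = (g (x i))%:E.
    move=> Vx; rewrite hQ ?nu_lim//.
    by apply: (probability_level _ (nu_lim Vx)) => w; exact: nu_level.
  split.
    apply: (eq_measurable_fun (fun x : towerT n => (g (x i))%:E)).
      by move=> x /set_mem Vx; rewrite nuB.
    exact: (measurable_fun_level (fun v => (g v)%:E)).
  transitivity (\int[mu]_(x in V) (g (x i))%:E)%E.
    by apply: eq_integral => x /set_mem; exact: nuB.
  rewrite (integral_level _ mu_lim (mu_level (i := i))).
  rewrite hQ// (probability_level _ mu_lim (mu_level (i := i))); congr EFin.
  rewrite -mulr_suml exchange_big /= mulr_suml; apply: eq_bigr => w _.
  by rewrite sum_adj mul1r.
- move=> B mB [mnB iB]; split.
    under eq_fun do rewrite probability_setC//.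
    by apply: emeasurable_funB.
  have mnCB : measurable_fun V (fun x => nu x (~` B)).
    by under eq_fun do rewrite probability_setC//; exact: emeasurable_funB.
  have : (\int[mu]_(x in V) nu x (~` B) + \int[mu]_(x in V) nu x B = 1)%E.
    rewrite -ge0_integralD//.
    under eq_integral => x _ do rewrite probability_setC// subeK ?fin_num_measure//.
    rewrite integral_cst// mul1e; exact: mu_lim.
  rewrite iB probability_setC// => <-.
  by rewrite addeK// fin_num_measure.
- move=> F mF tF hF.
  have nuF x : nu x (\bigcup_k F k) = (\sum_(k <oo) nu x (F k))%E.
    by rewrite measure_semi_bigcup//; exact: bigcupT_measurable.
  split.
    under eq_fun do rewrite nuF.
    by apply: ge0_emeasurable_sum => // k _; have [] := hF k.
  under eq_integral do rewrite nuF.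
  rewrite integral_nneseries//; last by move=> k; have [] := hF k.
  rewrite measure_semi_bigcup//; last exact: bigcupT_measurable.
  by apply: eq_eseriesr => k _; have [] := hF k.
Qed.

End LimitOperator.

(** * Approximation of measurable sets by level sets *)

Section Approximation.
Context {R : realType} {n : nat -> nat}.
Variables (f : forall i, 'I_(n i.+1).+1 -> 'I_(n i).+1)
  (mu : probability (towerT n) R).
Notation V := (inv_limit f).

(** The exceptional set is kept explicit, so that several approximations merge by uniting their
    exceptional sets and [A] need not be measurable. *)
Definition approximable (B : set (towerT n)) := forall e : R, 0 < e ->
  exists i (A D : set (towerT n)), [/\ level_fun f i A, measurable D,
    (mu D <= e%:E)%E & forall x, V x -> ~ D x -> A x = B x].

Lemma approximable_family (I : finType) (B : I -> set (towerT n)) (e : R) :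
  (forall l, approximable (B l)) -> 0 < e ->
  exists i (A : I -> set (towerT n)) (D : set (towerT n)),
  [/\ forall l, level_fun f i (A l), measurable D, (mu D <= e%:E)%E &
      forall x, V x -> ~ D x -> forall l, A l x = B l x].
Proof.
move=> hB e0.
have c0 : 0 < #|I|.+1%:R :> R by rewrite ltr0n.
have /choice[t ht] : forall l, exists t : nat * (set (towerT n) * set (towerT n)),
    [/\ level_fun f t.1 t.2.1, measurable t.2.2,
     (mu t.2.2 <= (e / #|I|.+1%:R)%:E)%E &
     forall x, V x -> ~ t.2.2 x -> t.2.1 x = B l x].
  move=> l; have [|i [A [D h]]] := hB l (e / #|I|.+1%:R); first exact: divr_gt0.
  by exists (i, (A, D)).
exists (\max_l (t l).1), (fun l => (t l).2.1),
  (\bigcup_(l in [set l | true]) (t l).2.2); split.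
- by move=> l; have [h _ _ _] := ht l; apply: level_fun_le h; exact: leq_bigmax.
- by apply: measurable_bigcup_fin => l; have [] := ht l.
- apply: le_trans (le_measure_bigcup_fin _ _ _) _; first by move=> l; have [] := ht l.
  apply: (@le_trans _ _ (\sum_(l : I) (e / #|I|.+1%:R)%:E)%E).
    by apply: lee_sum => l _; have [] := ht l.
  rewrite sumEFin sumr_const lee_fin -[leLHS]mulr_natl mulrCA ler_piMr ?(ltW e0)//.
  by rewrite ler_pdivrMr// mul1r ler_nat.
- move=> x Vx nD l; have [_ _ _] := ht l; apply => // Dl.
  by apply: nD; exists l.
Qed.

(** What the first N sets miss of the union decreases to the empty set, so by continuity from above
    it has mass at most e/2 for some N; the first N sets are approximated jointly with the other
    e/2. *)
Lemma approximable_bigcup (F : nat -> set (towerT n)) :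
  (forall k, measurable (F k)) -> (forall k, approximable (F k)) ->
  approximable (\bigcup_k F k).
Proof.
move=> mF hF; have mUF := bigcupT_measurable _ mF.
move=> e e0.
  have e20 : 0 < e / 2 by rewrite divr_gt0.
  pose E N := \bigcup_k F k `\` \bigcup_(k < N) F k.
  have mE N : measurable (E N).
    by apply: measurableD => //; apply: bigcup_measurable.
  have [N EN] : exists N, (mu (E N) <= (e / 2)%:E)%E.
    have : mu \o E @ \oo --> mu (\bigcap_k E k).
      apply: nonincreasing_cvg_mu => //.
      - by rewrite (le_lt_trans (probability_le1 _ _))// ltry.
      - exact: bigcapT_measurable.
      - move=> k l kl; apply/subsetPset => x [Ux nx]; split => // -[j /= jk Fj].
        by apply: nx; exists j => //=; exact: leq_trans kl.
    rewrite (_ : \bigcap_k E k = set0); last first.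
      apply/seteqP; split => // x Ex.
      have [[k _ Fk] _] := Ex 0%N I.
      by have [_] := Ex k.+1 I; apply; exists k => //=.
    rewrite measure0 => /fine_cvgP[_ /cvgrPdist_lt/(_ _ e20)[N _ /(_ N (leqnn N))]].
    rewrite /= sub0r normrN ger0_norm ?fine_ge0// => h.
    by exists N; rewrite -(@fineK _ (mu (E N))) ?fin_num_measure// lee_fin ltW.
  have [|i [A [D [Ai mD De h]]]] := @approximable_family 'I_N F (e / 2) _ e20.
    by move=> l; exact: hF.
  exists i, (\bigcup_(k in [set k : 'I_N | true]) A k), (D `|` E N); split.
  + move=> x y Vx Vy xy; rewrite /bigcup /mkset; apply/propext.
    have Axy k : A k x = A k y by exact: Ai.
    by split=> -[k _ Ak]; exists k => //; rewrite ?Axy// -Axy.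
  + exact: measurableU.
  + apply: le_trans (measureU2 _ _ _) _ => //.
    by rewrite [e]splitr EFinD leeD.
  + move=> x Vx /not_orP[nD nE]; rewrite /bigcup /mkset; apply/propext; split.
      by move=> [k _]; rewrite h// => Fk; exists (k : nat).
    move=> UF; have [[k /= kN Fk]|nk] := pselect ((\bigcup_(k < N) F k) x).
      by exists (Ordinal kN) => //; rewrite h.
    by exfalso; apply: nE; split.
Qed.

Lemma measurable_approximable (B : set (towerT n)) :
  measurable B -> approximable B.
Proof.
move=> mB; suff [] : measurable B /\ approximable B by [].
move: B mB; apply: smallest_sub; last first.
  move=> _ [i [w ->]]; split; first exact: (measurable_level (fun v => v = w)).
  move=> e e0; exists i, [set x : towerT n | x i = w], set0; split => //.
    by move=> x y _ _ /= ->.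
  by rewrite measure0 lee_fin ltW.
split.
- split => // e e0; exists 0%N, set0, set0; split => //.
  by rewrite measure0 lee_fin ltW.
- move=> B [mB aB]; rewrite setTD; split; first exact: measurableC.
  move=> e e0; have [i [A [D [Ai mD De h]]]] := aB e e0.
  exists i, (~` A), D; split => // [x y Vx Vy xy|x Vx nD].
    by rewrite /setC /mkset (Ai x y).
  by rewrite /setC /mkset h.
- move=> F hF; split; first by apply: bigcupT_measurable => k; have [] := hF k.
  by apply: approximable_bigcup => k; have [] := hF k.
Qed.

End Approximation.

(** * Averages of bounded functions and their dependence on the kernel *)

Section Averages.
Context {dT : measure_display} {T : measurableType dT} {R : realType}.
Variables (p : probability T R) (V : set T).
Hypotheses (mV : measurable V) (pV : p V = 1%E).

Let int (g : T -> R) (C : R) : measurable_fun V g -> (forall x, V x -> `|g x| <= C) ->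
  p.-integrable V (EFin \o g).
Proof. exact: probability_bounded_integrable. Qed.

Lemma Rintegral_average_cst (r : R) : \int[p]_(x in V) r = r.
Proof.
by rewrite Rintegral_cst// (_ : fine _ = 1) ?mulr1//; exact: (congr1 fine pV).
Qed.

(** The difference is majorized by [r + 2 * \1_D], the 2 coming from the unit bounds on both
    functions. *)
Lemma Rintegral_average_dist (g h : T -> R) (D : set T) (r : R) : 0 <= r ->
  measurable_fun V g -> (forall x, V x -> `|g x| <= 1) ->
  measurable_fun V h -> (forall x, V x -> `|h x| <= 1) -> measurable D ->
  (forall x, V x -> ~ D x -> `|g x - h x| <= r) ->
  `|(\int[p]_(x in V) g x) - \int[p]_(x in V) h x| <= r + 2 * fine (p D).
Proof.
move=> r0 mg bg mh bh mD gh.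
have ig := int mg bg; have ih := int mh bh.
have gh2 x : V x -> `|g x - h x| <= 2.
  move=> Vx; rewrite (le_trans (ler_normB _ _))// (_ : 2 = 1 + 1 :> R)//.
  by rewrite lerD ?bg ?bh.
have mB : measurable_fun V (fun x => g x - h x) by exact: measurable_funB.
have iB := int mB gh2.
have iD : p.-integrable V (EFin \o (\1_D : T -> R)).
  apply: (int (C := 1)) => // x _; rewrite indicE.
  by case: (_ \in _); rewrite ?normr1 ?normr0.
have iD2 : p.-integrable V (EFin \o (fun x => 2 * \1_D x)).
  by rewrite /comp; under eq_fun do rewrite EFinM; exact: integrableZl.
have ic : p.-integrable V (EFin \o (cst r)) by exact: finite_measure_integrable_cst.
rewrite -RintegralB//; apply: le_trans (le_normr_Rintegral _ _) _ => //.
apply: (@le_trans _ _ (\int[p]_(x in V) (r + 2 * \1_D x))).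
  apply: le_Rintegral => //.
  - exact: integrable_abse iB.
  - by rewrite /comp; under eq_fun do rewrite EFinD; exact: integrableD.
  - move=> x Vx; rewrite indicE; have [Dx|nD] := pselect (D x).
      by rewrite mem_set// mulr1 (le_trans (gh2 _ Vx))// lerDr.
    by rewrite memNset// mulr0 addr0 gh.
rewrite RintegralD// RintegralZl// Rintegral_average_cst lerD2l ler_pM2l//.
rewrite /Rintegral integral_indic// fine_le ?fin_num_measure//.
  exact: measurableI.
by rewrite le_measure ?inE//; exact: measurableI.
Qed.

Lemma Rintegral_average_le1 (g : T -> R) :
  measurable_fun V g -> (forall x, V x -> `|g x| <= 1) ->
  `|\int[p]_(x in V) g x| <= 1.
Proof.
move=> mg bg; have ig := int mg bg.
apply: le_trans (le_normr_Rintegral _ _) _ => //.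
apply: (@le_trans _ _ (\int[p]_(x in V) (cst 1 x))).
  apply: le_Rintegral => //; first exact: integrable_abse ig.
  exact: finite_measure_integrable_cst.
by rewrite Rintegral_average_cst.
Qed.

End Averages.

Section KernelAverages.
Context {dT : measure_display} {T : measurableType dT} {R : realType}.
Variables (p0 : probability T R) (p : T -> probability T R) (V : set T).
Hypotheses (mV : measurable V) (pV : forall x, V x -> p x V = 1%E)
  (mp : forall B, measurable B -> measurable_fun V (fun x => p x B)).

Lemma measurable_fun_average (g : T -> R) :
  measurable_fun V g -> (forall x, V x -> `|g x| <= 1) ->
  measurable_fun V (fun x => \int[p x]_(y in V) g y).
Proof.
move=> mg bg.
(* [p] is only controlled on [V], whereas the library lemma needs a kernel on [T] *)
pose q x : probability T R := if `[< V x >] then p x else p0.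
have qV x : V x -> q x = p x by move=> Vx; rewrite /q asboolT.
have mq B : measurable B -> measurable_fun setT (fun x => q x B).
  move=> mB; rewrite -(setUv V); apply/measurable_funU => //; first exact: measurableC.
  split.
    apply: (eq_measurable_fun (fun x => p x B)); last exact: mp.
    by move=> x /set_mem Vx; rewrite qV.
  apply: (eq_measurable_fun (cst (p0 B))); last exact: measurable_cst.
  by move=> x /set_mem nVx; rewrite /q asboolF.
(* The shift makes the integrand nonnegative; as [p x V = 1], it adds exactly 1 to the average and
   is subtracted again below. *)
pose h := (fun y => (g y + 1)%:E) \_ V.
have h0 y : (0 <= h y)%E.
  rewrite /h patchE; case: ifPn => // /set_mem Vy.
  by rewrite lee_fin -lerBlDr sub0r; have := bg _ Vy; rewrite ler_norml => /andP[].
have mh : measurable_fun setT h.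
  apply/(measurable_restrictT _ mV)/measurable_EFinP.
  exact: measurable_funD.
have mI := measurable_fun_integral_kernel mq h0 mh.
apply: (eq_measurable_fun (fun x => fine (\int[q x]_y h y)%E - 1)).
  move=> x /set_mem Vx; rewrite qV//.
  have ig := probability_bounded_integrable (p x) mV mg bg.
  rewrite /h -integral_mkcond; apply/eqP; rewrite subr_eq; apply/eqP.
  rewrite -[RHS](_ : \int[p x]_(y in V) (g y + 1) = _)//.
  rewrite RintegralD// ?Rintegral_average_cst ?pV//.
  exact: finite_measure_integrable_cst.
apply: measurable_funB => //.
have mIV : measurable_fun V (fun x => \int[q x]_y h y)%E by exact: measurable_funTS.
exact: (measurableT_comp (fine_measurable measurableT) mIV).
Qed.

End KernelAverages.

(** * Approximation of test functions by level functions *)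

Section StepApproximation.
Context {R : realType} {n : nat -> nat}.
Variables (f : forall i, 'I_(n i.+1).+1 -> 'I_(n i).+1)
  (mu : probability (towerT n) R).
Notation V := (inv_limit f).

Lemma sum_ltn_ord (N t : nat) : (t <= N)%N -> (\sum_(l < N) (l < t) = t)%N.
Proof.
move=> tN; transitivity (\sum_(l < t) 1)%N; last first.
  by rewrite big_const_ord iter_addn_0 mul1n.
rewrite (big_ord_widen N (fun=> 1%N) tN) [RHS]big_mkcond /=.
by apply: eq_bigr => l _; case: ltnP.
Qed.

(** The floor of the scaled value is the number of integer thresholds it reaches. Each superlevel
    set is replaced by a level set and the thresholds are counted again, with one level and one
    exceptional set for all j. *)
Lemma level_fun_approx (k : nat) (v : 'I_k -> towerT n -> R) (r e : R) :
  0 < r -> 0 < e -> (forall j, measurable_fun V (v j)) ->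
  (forall j x, V x -> `|v j x| <= 1) ->
  exists i (u : 'I_k -> towerT n -> R) (D : set (towerT n)),
  [/\ measurable D, (mu D <= e%:E)%E, forall j, level_fun f i (u j),
    forall j x, `|u j x| <= 1 &
    forall x, V x -> ~ D x -> forall j, `|v j x - u j x| <= r].
Proof.
move=> r0 e0 mv bv; have mV := measurable_inv_limit f.
have [M hM] := ex_succn_gt (2 / r).
have M0 : 0 < M.+1%:R :> R by rewrite ltr0n.
have Mr : 2 / M.+1%:R <= r by rewrite ler_pdivrMr// mulrC -ler_pdivrMr// ltW.
pose B (jl : 'I_k * 'I_M.+1) : set (towerT n) :=
  V `&` v jl.1 @^-1` [set t | jl.2.+1%:R <= grid_scale M t].
have mB jl : measurable (B jl).
  apply: mv => //.
  rewrite (_ : [set t | _] = [set` `[2 * jl.2.+1%:R / M.+1%:R - 1, +oo[%R]).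
    exact: measurable_itv.
  apply/seteqP; split => t; rewrite /grid_scale /= in_itv/= andbT;
  rewrite lerBlDr ler_pdivrMr//; lra.
have [i [A [D [Ai mD De h]]]] :=
  approximable_family (fun jl => measurable_approximable f mu (mB jl)) e0.
(* The inverse of [grid_scale] applied to the count. The count lies in [0, M+1] everywhere, so the
   unit bound holds even on [D]. *)
exists i, (fun j x => 2 / M.+1%:R * (\sum_(l < M.+1) `[< A (j, l) x >])%:R - 1), D.
have scale_u j x : 0 <= ((\sum_(l < M.+1) `[< A (j, l) x >])%:R : R) <= M.+1%:R.
  rewrite ler0n ler_nat /= -[leqRHS]card_ord -sum1_card.
  by apply: leq_sum => l _; case: asbool.
split => //.
- move=> j x y Vx Vy xy /=; congr (_ * _%:R - _).
  by apply: eq_bigr => l _; rewrite (Ai (j, l) x y).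
- move=> j x; have /andP[s0 s1] := scale_u j x; move: s0 s1.
  set s := (_ %:R : R) => s0 s1.
  have p0 : 0 <= s / M.+1%:R by rewrite divr_ge0 // ltW.
  have p1 : s / M.+1%:R <= 1 by rewrite ler_pdivrMr// mul1r.
  have -> : 2 / M.+1%:R * s = 2 * (s / M.+1%:R) by rewrite mulrAC mulrA.
  move: p0 p1; set q := s / _ => p0 p1.
  by rewrite ler_norml; apply/andP; split; lra.
- move=> x Vx nD j; apply: le_trans Mr.
  set s : R := (\sum_(l < M.+1) _)%:R.
  have g01 := grid_scale_itv M (bv j x Vx).
  have /andP[g0 g1] := g01.
  have sE : s = (Num.truncn (grid_scale M (v j x)))%:R.
    rewrite /s; congr _%:R.
    rewrite -[RHS](@sum_ltn_ord M.+1); last first.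
      by rewrite -(ler_nat R) (le_trans _ g1)// truncn_le.
    apply: eq_bigr => l _; rewrite h// truncn_ge_nat//; congr nat_of_bool.
    by apply/asboolP/idP => [[_]|gl] //; split.
  have /andP[t0 t1] := truncn_itv g0.
  rewrite -natr1 -sE in t1; rewrite -sE in t0.
  have -> : v j x - (2 / M.+1%:R * s - 1) = (grid_scale M (v j x) - s) * (2 / M.+1%:R).
    by rewrite /grid_scale; field.
  rewrite normrM (@ger0_norm _ (2 / _))// ler_piMl//.
  by rewrite ler_norml; apply/andP; split; lra.
Qed.

End StepApproximation.

(** * Convergence of the weighted series of distances *)

(** Terms beyond M contribute at most 2^-M uniformly in i because h <= 1; the finitely many others
    are small from a common index on, and their weights sum to at most 1. *)
Lemma weighted_series_cvg0 (R : realType) (h : nat -> nat -> R) :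
  (forall k i, 0 <= h k i <= 1) ->
  (forall k, (0 < k)%N -> forall e, 0 < e ->
    exists N, forall i, (N <= i)%N -> h k i <= e) ->
  (fun i => limn (fun K => \sum_(1 <= k < K) (2 ^- k) * h k i)) @ \oo --> (0 : R).
Proof.
move=> h01 hlim; pose S i K := \sum_(1 <= k < K) (2 ^- k) * h k i.
have w0 k : 0 <= 2 ^- k :> R by rewrite invr_ge0 exprn_ge0.
have S_ge0 i K : 0 <= S i K.
  by apply: sumr_ge0 => k _; have /andP[h0 _] := h01 k i; exact: mulr_ge0.
(* [c k - c k.+1] is a telescoping majorant of [2 ^- k * h k i] *)
have S_le i K a M : 0 <= a -> (forall k, (0 < k <= M)%N -> h k i <= a) ->
    S i K <= a + 2 ^- M.
  move=> a0 ha; pose c k : R := - (a * 2 ^- k.-1 + 2 ^- maxn k.-1 M).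
  have c0 k : c k <= 0 by rewrite oppr_le0 addr_ge0 ?mulr_ge0.
  have [K1|K1] := leqP K 1.
    by rewrite /S big_geq// addr_ge0.
  apply: (@le_trans _ _ (\sum_(1 <= k < K) (c k.+1 - c k))); last first.
    rewrite telescope_sumr ?(ltnW K1)//.
    have -> : c 1%N = - (a + 2 ^- M) by rewrite /c /= max0n expr0 invr1 mulr1.
    have := c0 K; lra.
  rewrite /S !big_nat; apply: ler_sum => -[//|k] _; rewrite /c /=.
  have /andP[h0 h1] := h01 k.+1 i.
  have wk : 2 ^- k = 2 * 2 ^- k.+1 :> R.
    by rewrite exprS invfM mulrA divff ?mul1r// pnatr_eq0.
  have [kM|Mk] := ltnP k M.
    have hk := ha k.+1 kM; have := w0 k.+1.
    rewrite (maxn_idPr kM) wk.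
    set w := 2 ^- k.+1 => w1; nra.
  have := w0 k.+1; rewrite (maxn_idPl (leqW Mk)) wk.
  set w := 2 ^- k.+1 => w1; nra.
have S_cvg i : cvgn (S i).
  apply: nondecreasing_is_cvgn.
    apply/nondecreasing_seqP => K; rewrite /S.
    case: K => [|K]; first by rewrite !big_geq.
    rewrite [leRHS]big_nat_recr//= lerDl.
    by have /andP[h0 _] := h01 K.+1 i; exact: mulr_ge0.
  exists (1 + 2 ^- 0) => _ [K _ <-]; apply: S_le => // k _.
  by have /andP[] := h01 k i.
apply/cvgrPdist_le => e e0; have e20 : 0 < e / 2 by rewrite divr_gt0.
have [M _ /(_ M (leqnn M)) hM] := near_infty_natSinv_expn_lt (PosNum e20).
have /choice[N hN] : forall k : 'I_M, exists N,
    forall i, (N <= i)%N -> h k.+1 i <= e / 2.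
  by move=> k; exact: hlim.
exists (\max_k N k) => // i /= Ni; rewrite sub0r normrN ger0_norm; last first.
  by apply: limr_ge; [exact: (S_cvg i)|near=> K; exact: S_ge0].
apply: limr_le; [exact: (S_cvg i)|near=> K]; apply: (@le_trans _ _ (e / 2 + 2 ^- M)).
  apply: S_le => [|[//|k] kM]; first exact: ltW.
  have := hN (Ordinal kM) i; apply; apply: leq_trans Ni.
  exact: (leq_bigmax (Ordinal kM)).
rewrite [leRHS]splitr lerD2l ltW//; apply: le_lt_trans hM => /=.
by rewrite div1r.
Unshelve. all: by end_near. Qed.

(** [Q] sees the index so that it can also express closeness to the matching coordinate of another
    vector. *)
Lemma joint_coord (R : realType) k (v w : 'I_k -> R) (Q : 'I_(k + k) -> R -> Prop) :
  (forall j, Q (lshift k j) (v j)) -> (forall j, Q (rshift k j) (w j)) ->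
  forall j, Q j (joint v w ord0 j).
Proof.
move=> hv hw j; rewrite /joint.
by case: (split_ordP j) => i ->; rewrite ?row_mxEl ?row_mxEr mxE.
Qed.

(** * Profiles of the finite operators and of their limit *)

Section Profiles.
Context {R : realType} {n : nat -> nat}.
Variables (adj : forall i, rel 'I_(n i).+1)
  (f : forall i, 'I_(n i.+1).+1 -> 'I_(n i).+1) (d : nat -> nat)
  (mu : probability (towerT n) R) (nu : towerT n -> probability (towerT n) R).
Notation V := (inv_limit f).
Hypotheses (adj_sym : forall i, symmetric (@adj i)) (d_gt0 : forall i, (0 < d i)%N)
  (adj_reg : forall i, regular (@adj i) (d i)) (mu_lim : mu V = 1%E)
  (mu_level : forall i (w : 'I_(n i).+1),
    mu [set x : towerT n | x i = w] = ((n i).+1%:R^-1)%:E)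
  (nu_lim : forall x, V x -> nu x V = 1%E)
  (nu_level : forall x, V x -> forall i (w : 'I_(n i).+1),
    nu x [set y : towerT n | y i = w] = ((adj (x i) w)%:R / (d i)%:R)%:E).

Let mV : measurable V := measurable_inv_limit f.
Let stationary := nu_stationary adj_sym d_gt0 adj_reg mu_lim mu_level nu_lim nu_level.
Notation A := (limit_op V nu).
Notation SG k i := (Sk_fin k (adj_op (@adj i) ((d i)%:R : R))).
Notation SA k := (Sk_meas V mu k A).

Definition profile k (v : 'I_k -> towerT n -> R) (x : towerT n) : 'rV[R]_(k + k) :=
  joint (fun j => v j x) (fun j => A (v j) x).

Definition unit_bounded k (v : 'I_k -> towerT n -> R) :=
  forall j, measurable_fun V (v j) /\ forall x, V x -> `|v j x| <= 1.

Lemma limit_op_le1 (g : towerT n -> R) x : measurable_fun V g ->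
  (forall y, V y -> `|g y| <= 1) -> V x -> `|A g x| <= 1.
Proof. by move=> mg bg Vx; exact: (Rintegral_average_le1 mV (nu_lim Vx)). Qed.

Lemma profile_measurable k v : @unit_bounded k v -> coord_measurable V (profile v).
Proof.
move=> hv j; rewrite /profile /joint.
case: (split_ordP j) => i ->.
  by under eq_fun do rewrite row_mxEl mxE; have [] := hv i.
under eq_fun do rewrite row_mxEr mxE.
have [mvi bvi] := hv i.
by apply: (measurable_fun_average mu mV nu_lim) => // B mB; have [] := stationary mB.
Qed.

Lemma profile_le1 k v : @unit_bounded k v ->
  forall x, V x -> forall j, `|profile v x ord0 j| <= 1.
Proof.
move=> hv x Vx; apply: (joint_coord (Q := fun _ t => `|t| <= 1)) => j.
  by have [_] := hv j; exact.
by have [mj bj] := hv j; exact: limit_op_le1.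
Qed.

(** Functions of coordinate i are preserved by [A]. Symmetry of the graph reconciles the edge
    directions used in [adj_op] and in the hypothesis on [nu]. *)
Lemma limit_op_level i (g : 'I_(n i).+1 -> R) x : V x ->
  A (fun y => g (y i)) x = adj_op (@adj i) (d i)%:R g (x i).
Proof.
move=> Vx; rewrite /limit_op (integral_level _ (nu_lim Vx) (nu_level Vx (i := i))) /=.
rewrite /adj_op mulr_sumr [RHS]big_mkcond; apply: eq_bigr => w _.
by rewrite adj_sym; case: adj; rewrite ?mul0r ?mulr0// mul1r mulrC.
Qed.

(** This realizes a finite profile on V, which gives the inclusion into S_k(A) and makes
    [lp_close_coupling] applicable. *)
Lemma Sk_fin_law k i (g : 'I_k -> 'I_(n i).+1 -> R) :
  (fun E => #|[set w : 'I_(n i).+1 | `[< E (joint (fun j => g j w)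
     (fun j => adj_op (@adj i) (d i)%:R (g j) w)) >]]|%:R / (n i).+1%:R) =
  law mu V (profile (fun j x => g j (x i))).
Proof.
apply/funext => E; rewrite /law.
pose Q w := E (joint (fun j => g j w) (fun j => adj_op (@adj i) (d i)%:R (g j) w)).
rewrite (_ : V `&` _ = [set x : towerT n | Q (x i)] `&` V); last first.
  have eqQ x : V x -> E (profile (fun j y => g j (y i)) x) = Q (x i).
    move=> Vx; rewrite /Q /profile; congr (E (joint _ _)).
    by apply/funext => j; exact: limit_op_level.
  by apply/seteqP; split => x [h1 h2]; split=> //=; [rewrite -eqQ|rewrite eqQ].
rewrite (probability_setI_lim mu_lim (measurable_level Q)).
rewrite (probability_level Q mu_lim (mu_level (i := i))) /=.
rewrite sumr_const -[RHS]mulr_natl; congr (_%:R * _).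
apply: eq_card => w; rewrite [RHS]unfold_in.
by apply/idP/idP => [/set_mem//|h]; exact: mem_set.
Qed.

Lemma unit_bounded_level k i (g : 'I_k -> 'I_(n i).+1 -> R) :
  (forall j w, `|g j w| <= 1) -> unit_bounded (fun j (x : towerT n) => g j (x i)).
Proof. by move=> hg j; split => // ; exact: (measurable_fun_level (g j)). Qed.

Lemma Sk_fin_sub k i : SG k i `<=` SA k.
Proof.
move=> _ [g hg <-]; rewrite Sk_fin_law; exists (fun j x => g j (x i)) => //.
exact: unit_bounded_level.
Qed.

Lemma Sk_measP k P : SA k P -> exists2 v, @unit_bounded k v & P = law mu V (profile v).
Proof. by move=> [v hv <-]; exists v. Qed.

(* A test function is first replaced by a level function [u] agreeing with it up
   to [r] off a small set [D]; stationarity and Markov's inequality bound the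
   set of [x] for which [nu x D] exceeds [t]. *)
Lemma Sk_meas_approx k P (e : R) : SA k P -> 0 < e ->
  exists N, forall i, (N <= i)%N -> exists2 Q, SG k i Q & lp_close e P Q.
Proof.
move=> /Sk_measP[v hv ->] e0.
(* [c] is the coordinate bound of [eucl_dist_coord] in dimension 2k; [t] satisfies c/2 + 2t = c, the
   error allowed for the images; [q] solves q + q/t = e, the total mass allowed for the two
   exceptional sets. *)
pose c : R := e / (k + k).+1%:R; have c0 : 0 < c by rewrite divr_gt0.
pose t : R := c / 4; have t0 : 0 < t by rewrite divr_gt0.
pose q : R := e * t / (1 + t).
have q0 : 0 < q by rewrite divr_gt0 ?mulr_gt0 ?addr_gt0.
have c20 : 0 < c / 2 by rewrite divr_gt0.
have [|j x Vx|N [u [D [mD Dq uN bu vu]]]] :=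
  @level_fun_approx _ _ f mu _ v _ _ c20 q0.
- by move=> j; have [] := hv j.
- by have [_] := hv j; exact.
exists N => i Ni.
have /choice[g hg] : forall j, exists g : 'I_(n i).+1 -> R,
    (forall x, V x -> u j x = g (x i)) /\ (forall w, `|g w| <= 1).
  move=> j; have [g gE gV] := level_fun_factor mu_lim mu_level (level_fun_le Ni (uN j)).
  by exists g; split => // w; have [x Vx ->] := gV w.
have bg j w : `|g j w| <= 1 by have [] := hg j.
pose u' j (x : towerT n) := g j (x i).
have hu' : unit_bounded u' by exact: unit_bounded_level.
exists (law mu V (profile u')); first by rewrite -Sk_fin_law; exists g.
have [mnuD inuD] := stationary mD.
pose D2 := V `&` [set x | (t%:E <= `|nu x D|)%E].
have mD2 : measurable D2.
  by apply: emeasurable_fun_c_infty => //; exact: measurableT_comp.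
have muD2 : (mu D2 <= (q / t)%:E)%E.
  have := le_integral_abse mu mV mnuD t0.
  under eq_integral do rewrite gee0_abs//.
  rewrite inuD => h; have {}h := le_trans h Dq.
  rewrite -(@fineK _ (mu D2)) ?fin_num_measure// lee_fin ler_pdivlMr// mulrC.
  by rewrite -lee_fin EFinM fineK ?fin_num_measure.
apply: (@lp_close_coupling _ _ _ _ _ _ mV _ _ _ (D `|` D2)) => //.
- exact: profile_measurable.
- exact: profile_measurable.
- exact: measurableU.
- apply: le_trans (measureU2 _ _ _) _ => //.
  rewrite (_ : e = q + q / t) ?EFinD ?leeD//.
  by rewrite /q; field; rewrite !gt_eqF ?addr_gt0.
- move=> x Vx /not_orP[nD nD2]; apply: eucl_dist_coord => //.
  have vu' j : V x -> ~ D x -> `|v j x - u' j x| <= c / 2.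
    by move=> ? ?; have [hgj _] := hg j; rewrite /u' -hgj//; exact: vu.
  pose Q j s := `|s - profile u' x ord0 j| <= c.
  apply: (joint_coord (Q := Q)) => j; rewrite /Q /profile /joint.
    by rewrite row_mxEl mxE (le_trans (vu' _ Vx nD))//; lra.
  rewrite row_mxEr mxE; have [mvj bvj] := hv j; have [muj buj] := hu' j.
  apply: (@le_trans _ _ (c / 2 + 2 * fine (nu x D))).
    apply: (Rintegral_average_dist mV (nu_lim Vx)) => //; first exact: ltW.
    move=> y Vy nDy; have [hgj _] := hg j; rewrite /u' -hgj//; exact: vu.
  have : fine (nu x D) < t.
    rewrite -lte_fin fineK ?fin_num_measure// ltNge; apply/negP => h; apply: nD2.
    by split => //=; rewrite gee0_abs.
  rewrite /t; lra.
Qed.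

(* One representative per attained signature is approximated; there are only
   finitely many signatures. *)
Lemma Sk_meas_approx_uniform k (e : R) : 0 < e ->
  exists N, forall i, (N <= i)%N -> forall P, SA k P ->
    exists2 Q, SG k i Q & lp_close e P Q.
Proof.
(* Two steps of e/4, from [P] to the representative and on to [Q], combine to 2(e/4 + e/4) = e in
   [lp_close_trans]. *)
move=> e0; have e40 : 0 < e / 4 by rewrite divr_gt0.
have [F [sig hsig]] := law_totally_bounded (m := k + k) mu mV e40.
have /choice[N hN] : forall s : F, exists N, forall i, (N <= i)%N ->
    forall P, SA k P -> sig P = s -> exists2 Q, SG k i Q & lp_close e P Q.
  move=> s.
  have [[P0 [SP0 sP0]]|no] := pselect (exists P, SA k P /\ sig P = s); last first.
    by exists 0%N => i _ P SP sP; exfalso; apply: no; exists P.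
  have [N hN] := Sk_meas_approx SP0 e40.
  exists N => i Ni P SP sP; have [Q SQ P0Q] := hN i Ni; exists Q => //.
  have SQ' := Sk_fin_sub SQ.
  move: SP SP0 SQ' sP sP0 P0Q.
  move=> /Sk_measP[v hv ->] /Sk_measP[v0 hv0 ->] /Sk_measP[w hw ->] sP sP0 P0Q.
  rewrite (_ : e = 2 * (e / 4 + e / 4)); last by field.
  apply: lp_close_trans P0Q => //.
  - by apply: law_monotone => //; exact: profile_measurable.
  - by apply: law_monotone => //; exact: profile_measurable.
  - apply: hsig; rewrite ?sP ?sP0//; try exact: profile_measurable; exact: profile_le1.
exists (\max_s N s) => i Ni P SP; apply: (hN (sig P)) => //.
by apply: leq_trans Ni; exact: leq_bigmax.
Qed.

(** Any two laws are within distance 1, so only a point of S_k(G_i) to compare with is missing; the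
    zero test functions supply it. *)
Lemma hausdorff_Sk_le1 k i : hausdorff (SG k i) (SA k) <= 1.
Proof.
have S0 : SG k i (law mu V (profile (fun (j : 'I_k) (x : towerT n) => 0 : R))).
  rewrite -(@Sk_fin_law k i (fun _ _ => 0)); exists (fun _ _ => 0) => //= j w.
  by rewrite normr0.
have LP1 P Q : SA k P -> SA k Q -> levy_prokhorov P Q <= 1.
  move=> /Sk_measP[v hv ->] /Sk_measP[w hw ->].
  by apply: levy_prokhorov_law_le1 => //; exact: profile_measurable.
apply: hausdorff_le => // [P SP|Q SQ].
  by have SP' := Sk_fin_sub SP; exists P => //; exact: LP1.
exists (law mu V (profile (fun (j : 'I_k) (x : towerT n) => 0))) => //.
by apply: LP1 => //; exact: (Sk_fin_sub S0).
Qed.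

Lemma hausdorff_Sk_small k (e : R) : 0 < e -> exists N, forall i, (N <= i)%N ->
  hausdorff (SG k i) (SA k) <= e.
Proof.
move=> e0; have [N hN] := @Sk_meas_approx_uniform k e e0.
exists N => i Ni; apply: hausdorff_le => [|P SP|P SP]; first exact: ltW.
  have SP' := Sk_fin_sub SP; exists P => //; have [v hv ->] := Sk_measP SP'.
  apply: levy_prokhorov_le => //; apply: lp_close_refl => //.
  by apply: law_monotone => //; exact: profile_measurable.
have [Q SQ PQ] := hN i Ni P SP; exists Q => //.
by apply: levy_prokhorov_le => //; exact: lp_close_sym.
Qed.

(** A point of S_k(G_i) is already a point of S_k(A), hence is approximated directly in S_k(G_j),
    with no triangle inequality for [hausdorff]. *)
Lemma Sk_fin_dH_cauchy k : dH_cauchy (fun i => SG k i).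
Proof.
(* Halving only serves to turn the weak bound of [hausdorff_le] into a strict one. *)
move=> e e0; have e20 : 0 < e / 2 by rewrite divr_gt0.
have [N hN] := @Sk_meas_approx_uniform k _ e20.
exists N => i j Ni Nj; apply: (@le_lt_trans _ _ (e / 2)).
  2: by rewrite ltr_pdivrMr// ltr_pMr// ltr1n.
apply: hausdorff_le => [|P SP|P SP]; first exact: ltW.
  have [Q SQ PQ] := hN j Nj P (Sk_fin_sub SP); exists Q => //.
  exact: levy_prokhorov_le.
have [Q SQ PQ] := hN i Ni P (Sk_fin_sub SP); exists Q => //.
by apply: levy_prokhorov_le => //; exact: lp_close_sym.
Qed.

End Profiles.

Theorem theorem12p4 (R : realType) (n : nat -> nat)
  (adj : forall i, rel 'I_(n i).+1)
  (f : forall i, 'I_(n i.+1).+1 -> 'I_(n i).+1)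
  (d : nat -> nat)
  (mu : probability (towerT n) R)
  (nu : towerT n -> probability (towerT n) R) :
  (* uniform tower of d_i-regular graphs G_i on [n_i + 1] *)
  (forall i, simple_graph (adj i)) ->
  (forall i, exists a b, uniform_map (adj i.+1) (adj i) (f i) a b) ->
  (forall i, (0 < d i)%N) ->
  (forall i, regular (adj i) (d i)) ->
  (* mu: the probability measure on the inverse limit V with uniform pushforwards *)
  mu (inv_limit f) = 1%E ->
  (forall i (w : 'I_(n i).+1), mu [set x | x i = w] = ((n i).+1%:R^-1)%:E) ->
  (* nu x: the uniform measure on N(x) *)
  (forall x, inv_limit f x ->
     nu x (inv_limit f) = 1%E /\
     forall i (w : 'I_(n i).+1),
       nu x [set y | y i = w] = ((adj i (x i) w)%:R / (d i)%:R)%:E) ->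
  let SG := fun k i => Sk_fin k (adj_op (adj i) (d i)%:R) in
  let SA := fun k => Sk_meas (inv_limit f) mu k (limit_op (inv_limit f) nu) in
  (forall k, (0 < k)%N -> dH_cauchy (SG k)) /\
  (fun i => dM (fun k => SG k i) SA) @ \oo --> (0 : R).
Proof.
move=> simple _ d_gt0 adj_reg mu_lim mu_level hnu SG SA.
have adj_sym i : symmetric (adj i) by have [] := simple i.
have nu_lim x (Vx : inv_limit f x) := (hnu x Vx).1.
have nu_level x (Vx : inv_limit f x) := (hnu x Vx).2.
split=> [k _|].
  exact: (Sk_fin_dH_cauchy adj_sym d_gt0 adj_reg mu_lim mu_level nu_lim nu_level).
apply: weighted_series_cvg0 => [k i|k _ e e0].
  rewrite hausdorff_ge0.
  exact: (hausdorff_Sk_le1 adj_sym d_gt0 adj_reg mu_lim mu_level nu_lim nu_level).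
exact: (hausdorff_Sk_small adj_sym d_gt0 adj_reg mu_lim mu_level nu_lim nu_level).
Qed.
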